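(* Let $k\ge 1$ and let $\mathcal{L}=\{\mathcal{M}_1,\dots,\mathcal{M}_k\}$ be a system of $k$ loopless matroids on the same finite ground set $V$, and let $\bigcap\mathcal{L}=\bigcap_{i=1}^k\mathcal{M}_i$. Then $$R(\mathcal{L}):P\big(\bigcap\mathcal{L}\big)\le k.$$
   Context: A complex on $V$ is a non-empty family of subsets of $V$ closed under taking subsets; a matroid is identified with the complex of its independent sets; loopless means every singleton is independent. For a complex $\mathcal{C}$ on $V$, $P(\mathcal{C})\subseteq\mathbb{R}^V_{\ge 0}$ is the convex hull of the characteristic vectors $\mathbf{1}_S$, $S\in\mathcal{C}$. Let $R(\mathcal{L})=\bigcap_{i=1}^kP(\mathcal{M}_i)$. A polytope $Z\subseteq\mathbb{R}^V_{\ge 0}$ is closed down if $z\in Z$ and $0\le y\le z$ imply $y\in Z$. For closed-down polytopes $A,B\subseteq\mathbb{R}^V_{\ge 0}$, $B:A=\min\{t\in\mathbb{R}_{\ge 0}: tA\supseteq B\}$ ($\min\emptyset=\infty$), where $tA=\{ta:a\in A\}$. *)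

(* Defs.v *)
From HB Require Import structures.
From mathcomp Require Import all_boot all_order all_algebra.
From mathcomp Require Import all_classical all_reals.
From mathcomp Require Import convex.

Unset Printing Implicit Defensive.

Import Order.TTheory GRing.Theory Num.Theory.
Local Open Scope classical_set_scope.
Local Open Scope ring_scope.

Definition is_complex {V : finType} (C : {set {set V}}) : Prop :=
  C != finset.set0 /\
  (forall A B : {set V}, B \in C -> A \subset B -> A \in C).

(* A matroid is represented by its complex of independent sets; the second
   conjunct is the augmentation axiom. *)
Definition is_matroid {V : finType} (M : {set {set V}}) : Prop :=
  is_complex M /\
  (forall I J : {set V}, I \in M -> J \in M -> (#|I| < #|J|)%N ->
     exists2 x : V, x \in (J :\: I)%SET & (x |: I)%SET \in M).

Definition loopless {V : finType} (M : {set {set V}}) : Prop :=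
  forall v : V, [set v]%SET \in M.

Definition char_vec (R : realType) {V : finType} (S : {set V}) :
  {ffun V -> R^o} := [ffun v => (v \in S)%:R].

Definition convex_hull {R : realType} {E : lmodType R} (X : set E) : set E :=
  smallest (@convex_set R E) X.

Definition complex_polytope (R : realType) {V : finType} (C : {set {set V}}) :
  set {ffun V -> R^o} :=
  convex_hull [set char_vec R S | S in [set S : {set V} | S \in C]].

Definition system_polytope (R : realType) {V : finType} {k : nat}
  (L : 'I_k -> {set {set V}}) : set {ffun V -> R^o} :=
  \bigcap_(i in [set: 'I_k]) complex_polytope R (L i).

Definition dilate {R : realType} {E : lmodType R} (t : R) (A : set E) : set E :=
  [set t *: a | a in A].

(* The least element of [T], as an extended real; [+oo] if [T] is empty (or,
   more generally, has no least element). *)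
Definition min_or_oo {R : realType} (T : set R) : \bar R :=
  xget +oo%E [set m%:E | m in T `&` lbound T].

(* The ratio usually written B : A. For closed-down polytopes the set below,
   when nonempty, has a least element. *)
Definition dilation_ratio {R : realType} {E : lmodType R} (B A : set E) :
  \bar R :=
  min_or_oo [set t : R | 0 <= t /\ B `<=` dilate t A].

(* Main.v *)
Require Import Defs.
From HB Require Import structures.
From mathcomp Require Import all_boot all_order all_algebra.
From mathcomp Require Import all_classical all_reals.
From mathcomp Require Import interval_inference convex.
From mathcomp Require Import ring lra.

Set Implicit Arguments.
Unset Strict Implicit.
Unset Printing Implicit Defensive.
Import Order.TTheory GRing.Theory Num.Theory.
Local Open Scope ring_scope.

(** Write [C] for the intersection of the matroids. A point [x] lies in
[k P(C)] as soon as, for every real weight [w], some [S] in [C] satisfies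
[w.x <= k w(S)]; this is linear programming duality, obtained here from Farkas'
lemma ([mem_dilate_complex_polytope]). The theorem is therefore a statement about
weights, and it holds because the greedy algorithm is a [1/k]-approximation for
the intersection of [k] matroids, even against fractional solutions
([system_polytope_greedy]).

Indeed, run the greedy algorithm for [C] on the elements of positive weight, by
decreasing weight, and let [S] be its output. For a prefix [T] of the list,
every [v] in [T] outside [S] was rejected, so in some matroid [M_i] it cannot be
added to [S :&: T]. Hence the [M_i]-spans of [S :&: T] cover [T], and since [x]
is in [P(M_i)], its mass on the [i]-th span is at most [#|S :&: T|]. Summing
over [i], the mass of [x] on [T] is at most [k #|S :&: T|]
([system_polytope_maximal_le]). As the weights decrease along the list,
summation by parts ([abel_sum_ge0]) turns these prefix inequalities into
[w.x <= k w(S)].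

The ratio is defined as a least element, which has to be shown to exist. The
dual description of membership in [t P(C)] consists of inequalities that are
closed conditions on [t], so the infimum of the admissible [t] is itself
admissible ([dilation_ratio_le]). *)

(** * Farkas' lemma *)

(** Bartl's induction on the number of forms. If [a j] cannot be dropped, some
[w0] violates the implication without it, and then [a j w0 > 0]. Composing all
forms with the projection onto the kernel of [a j] along [w0] removes [a j];
the coefficient of [a j] is recovered by evaluating at [w0]. *)
Lemma farkas (R : realFieldType) (W : lmodType R) (J : eqType) (s : seq J)
    (a : J -> W -> R) (g : W -> R) :
  uniq s -> (forall j, scalar (a j)) -> scalar g ->
  (forall w, (forall j, j \in s -> a j w <= 0) -> g w <= 0) ->
  exists2 lam : J -> R, (forall j, 0 <= lam j) &
    forall w, g w = \sum_(j <- s) lam j * a j w.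
Proof.
elim: s a g => [|j s IHs] a g.
  move=> _ _ g_lin g_le0; exists (fun=> 0) => // w; rewrite big_nil.
  have g0 : g 0 = 0 by have := g_lin (-1) 0 0; rewrite scaler0 addr0; lra.
  have gN : g (- w) = - g w.
    by have := g_lin (-1) w 0; rewrite scaleN1r addr0 g0; lra.
  have := g_le0 w (fun _ => ltac:(by [])).
  by have := g_le0 (- w) (fun _ => ltac:(by [])); rewrite gN; lra.
move=> /=/andP[js s_uniq] a_lin g_lin g_le0.
have [redundant | /existsNP[w0 /not_implyP[w0_le0 /negP gw0_gt0]]] :=
  pselect (forall w, (forall i, i \in s -> a i w <= 0) -> g w <= 0).
  have [lam lam_ge0 gE] := IHs a g s_uniq a_lin g_lin redundant.
  exists (fun i => if i == j then 0 else lam i) => [i|w].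
    by case: ifP => _ //.
  rewrite big_cons eqxx mul0r add0r gE; apply: eq_big_seq => i i_s.
  by rewrite (negbTE (memPn js i i_s)).
rewrite -ltNge in gw0_gt0.
have c_gt0 : 0 < a j w0.
  rewrite ltNge; apply/negP => c_le0; move: gw0_gt0; rewrite ltNge g_le0 //.
  by move=> i; rewrite inE => /predU1P[->|/w0_le0].
set c := a j w0 in c_gt0.
(* [h f] is [f] composed with the projection along [w0] onto the kernel of
   [a j]. *)
pose h (f : W -> R) (w : W) := f w - f w0 / c * a j w.
have hE f w : scalar f -> h f w = f (w - (a j w / c) *: w0).
  by move=> f_lin; rewrite -[w - _]addrC -scaleNr f_lin /h; ring.
have h_lin f : scalar f -> scalar (h f).
  by move=> f_lin k u v; rewrite /h f_lin a_lin; ring.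
have [|||lam lam_ge0 hgE] := IHs (fun i => h (a i)) (h g) s_uniq.
- by move=> i; apply: h_lin.
- exact: h_lin.
- move=> w hw; rewrite hE //; apply: g_le0 => i; rewrite inE => /predU1P[->|i_s].
    by rewrite -hE // /h divff ?gt_eqF // mul1r subrr.
  by rewrite -hE //; apply: hw.
(* The identity for [g] must hold at [w0], which determines the coefficient. *)
pose mu := (g w0 - \sum_(i <- s) lam i * a i w0) / c.
exists (fun i => if i == j then mu else lam i) => [i|w].
  case: ifP => _ //; apply: divr_ge0; last exact: ltW.
  rewrite subr_ge0; apply: le_trans (ltW gw0_gt0).
  rewrite big_seq; apply: sumr_le0 => i' i's.
  by rewrite mulr_ge0_le0 // w0_le0.
rewrite big_cons eqxx.
under eq_big_seq => i i_s do rewrite (negbTE (memPn js i i_s)).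
have := hgE w; rewrite /h /= => /eqP; rewrite subr_eq => /eqP ->.
under eq_bigr => i _ do rewrite mulrBr.
rewrite sumrB /mu.
have -> : \sum_(i <- s) lam i * (a i w0 / c * a j w) =
          (\sum_(i <- s) lam i * a i w0) / c * a j w.
  by rewrite !mulr_suml; apply: eq_bigr => i _; rewrite !mulrA.
ring.
Qed.

(** * Dilated convex hulls *)

Section Hull.
Variables (R : realType) (E : lmodType R).
Implicit Types (X : set E) (t u : R).

Lemma convex_hull_convex X : convex_set (convex_hull X).
Proof.
move=> x y l; rewrite !inE => hx hy D [D_cvx XD].
have := D_cvx x y l; rewrite !inE; apply; [exact: hx | exact: hy].
Qed.

Lemma dilateD X t u x y : 0 <= t -> 0 <= u -> dilate t (convex_hull X) x ->
  dilate u (convex_hull X) y -> dilate (t + u) (convex_hull X) (x + y).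
Proof.
move=> t0 u0 [a Xa <-] [b Xb <-].
have [tu0|tu_neq0] := eqVneq (t + u) 0.
  have [-> ->] : t = 0 /\ u = 0 by split; lra.
  by exists a => //; rewrite !scale0r !addr0 scale0r.
have tu_gt0 : 0 < t + u by rewrite lt_neqAle eq_sym tu_neq0 addr_ge0.
have q_ge0 : 0 <= t / (t + u) by rewrite divr_ge0 // addr_ge0.
have q_le1 : t / (t + u) <= 1 by rewrite ler_pdivrMr // mul1r; lra.
have hq : Itv.spec (@Itv.num_sem R) (Itv.Real `[0%Z, 1%Z]) (t / (t + u)).
  by rewrite /= /Itv.num_sem/= num_real /= in_itv /= q_ge0 q_le1.
pose q : {i01 R} := Itv.mk hq.
exists (conv q (a : convex_lmodType E) b).
  by have := @convex_hull_convex X a b q; rewrite !inE; apply.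
rewrite /conv /= scalerDr !scalerA.
congr (_ *: _ + _ *: _); first by rewrite mulrC divfK.
by rewrite -[LHS]/((t + u) * (1 - t / (t + u))); field.
Qed.

(** Dilating by the sum of the coefficients replaces the normalisation of a conic
combination to a convex one, which would need a nonzero sum. *)
Lemma conic_comb_dilate X (J : eqType) (s : seq J) (lam : J -> R) (p : J -> E) :
  (exists x, X x) -> (forall j, 0 <= lam j) -> (forall j, j \in s -> X (p j)) ->
  dilate (\sum_(j <- s) lam j) (convex_hull X) (\sum_(j <- s) lam j *: p j).
Proof.
move=> [x0 Xx0] lam_ge0; elim: s => [|j s IHs] Xp.
  by rewrite !big_nil; exists x0; [exact: sub_gen_smallest|rewrite scale0r].
rewrite !big_cons; apply: dilateD => //.
- by apply: sumr_ge0.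
- by exists (p j) => //; apply: sub_gen_smallest; apply: Xp; rewrite mem_head.
by apply: IHs => i i_s; apply: Xp; rewrite inE i_s orbT.
Qed.
End Hull.

(** * Dilates of a complex polytope by linear inequalities *)

Section Pairing.
Variables (R : realType) (V : finType).
Implicit Types (w x y : {ffun V -> R^o}) (C : {set {set V}}).

Definition pairing w y : R := \sum_v w v * y v.

Lemma pairing_linear_l y : scalar (pairing^~ y).
Proof.
move=> k u v; rewrite /pairing mulr_sumr -big_split /=; apply: eq_bigr => i _.
by rewrite !ffunE mulrDl mulrA.
Qed.

Lemma pairing_linear_r w : scalar (pairing w).
Proof.
move=> k u v; rewrite /pairing mulr_sumr -big_split /=; apply: eq_bigr => i _.
by rewrite !ffunE mulrDr mulrCA.
Qed.

Lemma pairing0 w : pairing w 0 = 0.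
Proof. by rewrite /pairing big1 // => v _; rewrite ffunE mulr0. Qed.

Lemma pairing_scale w k y : pairing w (k *: y) = k * pairing w y.
Proof. by rewrite -[k *: y]addr0 pairing_linear_r pairing0 addr0. Qed.

Lemma pairing_char_vec w S : pairing w (char_vec R S) = \sum_(v in S) w v.
Proof.
rewrite big_mkcond; apply: eq_bigr => v _; rewrite ffunE.
by case: (v \in S); rewrite ?mulr1 ?mulr0.
Qed.

(** The half-space defined by [w] and [M] is convex, so it contains the hull of
its points. *)
Lemma complex_polytope_le C w (M : R) :
  (forall S, S \in C -> \sum_(v in S) w v <= M) ->
  forall y, complex_polytope R C y -> pairing w y <= M.
Proof.
move=> wM y Cy.
suff : (complex_polytope R C `<=` [set y | pairing w y <= M])%classic by apply.
apply: smallest_sub => [a b l|_ [S SC <-]] /=.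
  rewrite !inE /= => aM bM.
  rewrite /conv /= pairing_linear_r pairing_scale.
  set p := l%:num.
  have p0 : 0 <= p by rewrite /p ge0.
  have p1 : p <= 1 by rewrite /p le1.
  have -> : M = p * M + (1 - p) * M by ring.
  by rewrite lerD // ler_wpM2l // subr_ge0.
by rewrite pairing_char_vec wM.
Qed.

(** The separation theorem for the polytope, in homogeneous form: a pair
[(w, c)] is seen as the affine form [pairing w y + c], and Farkas' lemma writes
evaluation at [(x, t)] as a conic combination of evaluations at the vertices
[(char_vec R S, 1)]. *)
Lemma mem_dilate_complex_polytope C (t : R) x : C != finset.set0 -> 0 <= t ->
  (forall w (M : R), (forall S, S \in C -> \sum_(v in S) w v <= M) ->
     pairing w x <= t * M) ->
  dilate t (complex_polytope R C) x.
Proof.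
move=> /set0Pn[S0 S0C] t0 hx.
pose W : lmodType R := ({ffun V -> R^o} * R^o)%type.
pose a (S : {set V}) (w : W) : R := pairing w.1 (char_vec R S) + w.2.
pose g (w : W) : R := pairing w.1 x + t * w.2.
have a_lin S : scalar (a S).
  move=> k u v; have -> : a S (k *: u + v) =
    pairing (k *: u.1 + v.1) (char_vec R S) + (k * u.2 + v.2) by [].
  by rewrite pairing_linear_l /a; ring.
have g_lin : scalar g.
  move=> k u v; have -> : g (k *: u + v) =
    pairing (k *: u.1 + v.1) x + t * (k * u.2 + v.2) by [].
  by rewrite pairing_linear_l /g; ring.
have [|lam lam_ge0 gE] := farkas (enum_uniq (mem C)) a_lin g_lin.
  move=> [w c] wc_le0; rewrite /g /=.
  have : pairing w x <= - (t * c); last by lra.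
  have := hx w (- c); rewrite mulrN; apply => S SC.
  have := wc_le0 S; rewrite mem_enum SC /a /= pairing_char_vec.
  by move=> /(_ isT); lra.
(* Evaluate at the constant form [1] for [t], at coordinate forms for [x]. *)
have -> : t = \sum_(S <- enum C) lam S.
  have := gE ((0 : {ffun V -> R^o}), (1 : R^o)); rewrite /g /a /=.
  rewrite /pairing big1 => [|v _]; last by rewrite ffunE mul0r.
  rewrite add0r mulr1 => ->; apply: eq_bigr => S _.
  rewrite big1 => [|v _]; last by rewrite ffunE mul0r.
  by rewrite add0r mulr1.
have -> : x = \sum_(S <- enum C) lam S *: char_vec R S.
  apply/ffunP => v.
  have pairE y : pairing [ffun u => (u == v)%:R] y = y v.
    rewrite /pairing (bigD1 v) //= ffunE eqxx mul1r big1 ?addr0 // => u uv.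
    by rewrite ffunE (negbTE uv) mul0r.
  have := gE ([ffun u => (u == v)%:R], (0 : R^o)); rewrite /g /a /=.
  rewrite mulr0 addr0 pairE => ->; rewrite sum_ffunE; apply: eq_bigr => S _.
  by rewrite addr0 pairE !ffunE.
apply: conic_comb_dilate => //; first by exists (char_vec R S0), S0.
by move=> S; rewrite mem_enum => SC; exists S.
Qed.

(** The point is that the least admissible dilation exists: for fixed [w], [M]
and [b], the condition [pairing w b <= t * M] passes to the infimum over [t]
because [M >= 0], the empty set being in [C]. *)
Lemma dilation_ratio_le C (B : set {ffun V -> R^o}) (t0 : R) :
  finset.set0 \in C -> 0 <= t0 ->
  (B `<=` dilate t0 (complex_polytope R C))%classic ->
  (dilation_ratio B (complex_polytope R C) <= t0%:E)%E.
Proof.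
move=> C0 t0_ge0 Bt0; rewrite /dilation_ratio.
set T := (X in min_or_oo X).
have Tt0 : T t0 by [].
have T_lb : lbound T 0 by move=> t [].
have T_inf : has_lbound T by exists 0.
have inf_ge0 : 0 <= inf T by apply: lb_le_inf; [exists t0|].
suff T_min : T (inf T).
  rewrite /min_or_oo.
  have [m [_ m_min] <-] := @xgetPex _ +oo%E [set m%:E | m in T `&` lbound T]%classic
     (ex_intro _ (inf T)%:E (ex_intro2 _ _ (inf T) (conj T_min (ge_inf T_inf)) erefl)).
  by rewrite lee_fin m_min.
split=> // b Bb; apply: mem_dilate_complex_polytope => //.
  by apply/set0Pn; exists finset.set0.
move=> w M wM.
have le_T t : T t -> pairing w b <= t * M.
  move=> [t_ge0 /(_ b Bb)[y Cy <-]].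
  by rewrite pairing_scale ler_wpM2l // (complex_polytope_le wM).
have : 0 <= M by have := wM _ C0; rewrite big_set0.
rewrite le_eqVlt => /predU1P[M0|M_gt0].
  by have := le_T _ Tt0; rewrite -M0 !mulr0.
rewrite -ler_pdivrMr //; apply: lb_le_inf; first by exists t0.
by move=> t /le_T; rewrite ler_pdivrMr.
Qed.

End Pairing.

(** * Greedy sets and spans *)

Section Greedy.
Variables (V : finType).
Implicit Types (C M : {set {set V}}) (s : seq V).

Lemma complex0 C : is_complex C -> finset.set0 \in C.
Proof. by move=> [/set0Pn[A AC] C_down]; apply: (C_down finset.set0 A); rewrite ?finset.sub0set. Qed.

Lemma is_complex_bigcap (k : nat) (L : 'I_k -> {set {set V}}) :
  (forall i, is_complex (L i)) -> is_complex (\bigcap_(i < k) L i)%SET.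
Proof.
move=> L_cpx; split.
  by apply/set0Pn; exists finset.set0; apply/finset.bigcapP => i _; apply: complex0.
move=> A B /finset.bigcapP BL AB; apply/finset.bigcapP => i _.
by apply: (proj2 (L_cpx i)) AB; apply: BL.
Qed.

(** [S] is the output of the greedy algorithm on [s]. What is kept of the run is
that every prefix of [s] meets [S] in a maximal member of [C] within that
prefix. *)
Lemma greedy_set C s : is_complex C -> uniq s ->
  exists2 S : {set V}, S \in C /\ {subset S <= s} &
    forall n v, v \in take n s -> v \notin S ->
      (v |: (S :&: [set u in take n s]))%SET \notin C.
Proof.
move=> C_cpx; have C_down := proj2 C_cpx.
elim/last_ind: s => [|s v IHs].
  move=> _; exists finset.set0 => //; split; first exact: complex0.
  by move=> u; rewrite inE.
rewrite rcons_uniq => /andP[vs /IHs[S [SC Ss] S_max]].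
pose S' := if (v |: S)%SET \in C then (v |: S)%SET else S.
have S'C : S' \in C by rewrite /S'; case: ifP.
have SS' : S \subset S' by rewrite /S'; case: ifP => // _; apply: finset.subsetUr.
have S'_eq u : u \in s -> (u \in S') = (u \in S).
  move=> us; rewrite /S'; case: ifP => // _.
  by rewrite !inE; case: eqP us vs => // -> ->.
have S's : {subset S' <= rcons s v}.
  move=> u; rewrite mem_rcons inE /S'; case: ifP => _; rewrite ?inE.
    by case/predU1P => [->|/Ss->]; rewrite ?eqxx ?orbT.
  by move=> /Ss->; rewrite orbT.
exists S' => // n u.
have [n_le|n_gt] := leqP n (size s).
  rewrite -cats1 takel_cat // => u_n uS'.
  have u_s := mem_take u_n.
  suff -> : (S' :&: [set u in take n s])%SET = (S :&: [set u in take n s])%SET.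
    by apply: S_max => //; rewrite -S'_eq.
  apply/finset.setP => t; rewrite !inE; case t_n: (t \in take n s); rewrite ?andbF //.
  by rewrite S'_eq // (mem_take t_n).
rewrite take_oversize ?size_rcons // => u_s uS'.
have -> : (S' :&: [set u in rcons s v])%SET = S'.
  by apply/finset.setIidPl/fintype.subsetP => t /S's; rewrite inE.
apply/negP => uS'C; move: u_s; rewrite mem_rcons inE => /predU1P[u_v|u_s].
  move: uS' (C_down _ _ uS'C (finset.setUS [set u]%SET SS')).
  by rewrite u_v /S' => /[swap] ->; rewrite finset.setU11.
have u_take : u \in take (size s) s by rewrite take_size.
have := S_max _ _ u_take; rewrite -S'_eq // => /(_ uS')/negP; apply.
apply: C_down uS'C _; apply: finset.setUS; apply: fintype.subset_trans SS'.
exact: finset.subsetIl.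
Qed.

(** The set intersected with [J] is the span of [I] in [M]. Were its intersection
with [J] larger than [I], augmentation would extend [I] by an element of its
span. *)
Lemma spanned_indep_card M (I J : {set V}) : is_matroid M -> I \in M -> J \in M ->
  (#|(J :&: [set v | (v \in I) || ((v |: I) \notin M)])%SET| <= #|I|)%N.
Proof.
move=> [[_ M_down] M_aug] IM JM.
set U := (X in (_ :&: X)%SET).
have JUM : (J :&: U)%SET \in M by apply: M_down JM _; apply: finset.subsetIl.
rewrite leqNgt; apply/negP => /(M_aug _ _ IM JUM)[v].
by rewrite !inE => /andP[/negbTE->]/andP[_ /=] /negP.
Qed.

End Greedy.

(** * Summation by parts *)

(** The constant [c] carries the sum of [d] over the elements already passed, and
[W] the last weight met, for the induction on [s]. *)
Lemma abel_sum_ge0 (R : realDomainType) (V : eqType) (w d : V -> R) (s : seq V)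
    (c W : R) :
  sorted (fun u v => w v <= w u) s ->
  (forall v, v \in s -> 0 <= w v <= W) -> 0 <= W ->
  (forall n, 0 <= c + \sum_(v <- take n s) d v) ->
  0 <= W * c + \sum_(v <- s) w v * d v.
Proof.
elim: s c W => [|v s IHs] c W.
  by move=> _ _ W0 /(_ 0); rewrite !big_nil !addr0; apply: mulr_ge0.
move=> /= v_s w_bd W0 d_ge0.
have c0 : 0 <= c by have := d_ge0 0; rewrite take0 big_nil addr0.
have /andP[wv0 wvW] := w_bd v (mem_head v s).
have le_tr : transitive (fun u v => w v <= w u) by move=> a b e ab /le_trans; apply.
have /allP v_max := order_path_min le_tr v_s.
have := IHs (c + d v) (w v) (path_sorted v_s); rewrite big_cons => IH.
suff : 0 <= w v * (c + d v) + \sum_(u <- s) w u * d u by nra.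
apply: IH => // [u us|n].
  by have /andP[-> _] := w_bd u (mem_behead (s := v :: s) us); apply: v_max.
by have := d_ge0 n.+1; rewrite /= big_cons addrA.
Qed.

(** * The greedy bound for points of the system polytope *)

Section Main.
Variables (R : realType) (V : finType) (k : nat) (L : 'I_k -> {set {set V}}).
Implicit Types (x : {ffun V -> R^o}).

Lemma system_polytope_ge0 x v : (0 < k)%N -> system_polytope R L x -> 0 <= x v.
Proof.
move=> k_gt0 Lx.
have pairE y : pairing [ffun u => - (u == v)%:R] y = - y v.
  rewrite /pairing (bigD1 v) //= ffunE eqxx mulN1r big1 ?addr0 // => u uv.
  by rewrite ffunE (negbTE uv) oppr0 mul0r.
rewrite -oppr_le0 -pairE.
apply: complex_polytope_le (Lx (Ordinal k_gt0) I) => S _.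
by apply: sumr_le0 => u _; rewrite ffunE oppr_le0.
Qed.

(** The spans [U i] of [S] in the matroids cover [T] by maximality of [S], and the
mass of [x] on each is at most [#|S|], this being true at every vertex of
[P(L i)]. *)
Lemma system_polytope_maximal_le x (T S : {set V}) :
  (forall i, is_matroid (L i)) -> (0 < k)%N ->
  system_polytope R L x -> S \in (\bigcap_(i < k) L i)%SET ->
  (forall v, v \in T -> v \notin S -> (v |: S)%SET \notin (\bigcap_(i < k) L i)%SET) ->
  \sum_(v in T) x v <= k%:R * #|S|%:R.
Proof.
move=> L_mat k_gt0 Lx /finset.bigcapP SL S_max.
have x_ge0 v := system_polytope_ge0 v k_gt0 Lx.
pose U i := [set v | (v \in S) || ((v |: S)%SET \notin L i)]%SET.
have T_cover v : v \in T -> exists i, v \in U i.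
  move=> vT; have [vS|vS] := boolP (v \in S).
    by exists (Ordinal k_gt0); rewrite inE vS.
  have /negP vSC := S_max v vT vS; apply: contrapT => v_notU; apply: vSC.
  apply/finset.bigcapP => i _; apply: contraT => vSi.
  by case: v_notU; exists i; rewrite inE vSi orbT.
have U_le i : \sum_(v in U i) x v <= #|S|%:R.
  have -> : \sum_(v in U i) x v = pairing [ffun v => (v \in U i)%:R] x.
    rewrite big_mkcond; apply: eq_bigr => v _; rewrite ffunE.
    by case: ifP; rewrite ?mul1r ?mul0r.
  apply: complex_polytope_le (Lx i I) => J JL.
  under eq_bigr do rewrite ffunE.
  rewrite -natr_sum ler_nat; apply: leq_trans (spanned_indep_card (L_mat i) (SL i isT) JL).
  by rewrite -sum1_card big_mkcond /= [leqRHS]big_mkcond; apply: leq_sum => v _;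
    rewrite !inE; case: (v \in J) => //=; case: ifP.
apply: le_trans (_ : \sum_(i < k) \sum_(v in U i) x v <= _); last first.
  apply: le_trans (ler_sum _ (fun i _ => U_le i)) _.
  by rewrite sumr_const card_ord mulr_natl.
under [leRHS]eq_bigr do rewrite big_mkcond.
rewrite exchange_big /= big_mkcond; apply: ler_sum => v _.
case: ifP => [/T_cover[i vU]|_]; last by apply: sumr_ge0 => i _; case: ifP.
by rewrite (bigD1 i) //= vU lerDl sumr_ge0 // => j _; case: ifP.
Qed.

(** [S] is the greedy set for the elements of positive weight; the others only
lower [pairing w x], as [x >= 0]. *)
Lemma system_polytope_greedy x (w : {ffun V -> R^o}) :
  (forall i, is_matroid (L i)) -> (0 < k)%N ->
  system_polytope R L x ->
  exists2 S, S \in (\bigcap_(i < k) L i)%SET &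
    pairing w x <= k%:R * \sum_(v in S) w v.
Proof.
move=> L_mat k_gt0 Lx; set C := (\bigcap_(i < k) L i)%SET.
have x_ge0 v := system_polytope_ge0 v k_gt0 Lx.
pose s := sort (fun u v => w v <= w u) [seq v <- enum V | 0 < w v].
have s_uniq : uniq s by rewrite sort_uniq filter_uniq // enum_uniq.
have mem_s v : (v \in s) = (0 < w v) by rewrite mem_sort mem_filter mem_enum andbT.
have s_sorted : sorted (fun u v => w v <= w u) s.
  by apply: sort_sorted => u v; apply: le_total.
have C_cpx : is_complex C by apply: is_complex_bigcap => i; case: (L_mat i).
have [S [SC Ss] S_max] := greedy_set C_cpx s_uniq; exists S => //.
pose d v := k%:R * (v \in S)%:R - x v.
have prefix_ge0 n : 0 <= \sum_(v <- take n s) d v.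
  have tn_uniq := take_uniq n s_uniq.
  rewrite sumrB -mulr_sumr subr_ge0.
  pose T := [set v in take n s]%SET.
  have sumT F : \sum_(v <- take n s) F v = \sum_(v in T) F v :> R.
    by rewrite big_uniq //; apply: eq_bigl => v; rewrite inE.
  rewrite !sumT -natr_sum.
  have -> : (\sum_(v in T) (v \in S) = #|S :&: T|)%N.
    rewrite -sum1_card big_mkcond /= [RHS]big_mkcond; apply: eq_bigr => v _.
    by rewrite !inE; case: (v \in S); case: ifP.
  apply: system_polytope_maximal_le => // [|v vT].
    by apply: (proj2 C_cpx) SC _; apply: finset.subsetIl.
  rewrite !inE in vT *; rewrite vT andbT; exact: S_max.
(* Any upper bound of the weights serves as the initial weight, since [c = 0]. *)
have := @abel_sum_ge0 _ _ w d s 0 (\sum_v `|w v|) s_sorted.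
rewrite mulr0 add0r => abel.
have : 0 <= \sum_(v <- s) w v * d v.
  apply: abel => [v||n]; [rewrite mem_s => w_gt0 | exact: sumr_ge0 | by rewrite add0r].
  by rewrite ltW //= (bigD1 v) //= (gtr0_norm w_gt0) lerDl sumr_ge0.
have sum_s F : \sum_(v <- s) F v = \sum_(v | 0 < w v) F v :> R.
  by rewrite big_uniq //; apply: eq_bigl => v; rewrite mem_s.
under eq_bigr do rewrite mulrBr; rewrite sumrB !sum_s subr_ge0 => le_S.
apply: le_trans (_ : \sum_(v | 0 < w v) w v * x v <= _).
  rewrite [leRHS]big_mkcond; apply: ler_sum => v _.
  by case: ifPn => //; rewrite -leNgt => w_le0; rewrite mulr_le0_ge0.
apply: le_trans le_S _; rewrite mulr_sumr big_mkcond [leRHS]big_mkcond.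
apply: ler_sum => v _; case vS: (v \in S).
  by rewrite -mem_s Ss // mulr1 mulrC.
by rewrite !mulr0; case: ifP.
Qed.

End Main.

Theorem corollary10p14 (R : realType) (V : finType) (k : nat)
    (L : 'I_k -> {set {set V}}) (hk : (1 <= k)%N)
    (hmat : forall i : 'I_k, is_matroid (L i))
    (hloop : forall i : 'I_k, loopless (L i)) :
  (dilation_ratio (system_polytope R L)
                  (complex_polytope R (\bigcap_(i < k) L i)%SET) <= k%:R%:E)%E.
Proof.
have C_cpx : is_complex (\bigcap_(i < k) L i)%SET.
  by apply: is_complex_bigcap => i; case: (hmat i).
apply: dilation_ratio_le; [exact: complex0 | exact: ler0n |].
move=> x Lx; apply: mem_dilate_complex_polytope; [by case: C_cpx | exact: ler0n |].
move=> w M wM; have [S SC wx_le] := system_polytope_greedy w hmat hk Lx.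
by apply: le_trans wx_le _; rewrite ler_wpM2l ?ler0n ?wM.
Qed.
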